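(* The unidirectional maintenance scheduling problem with $n$ jobs can be solved in time $O(n^4)$.
   Context: The unidirectional maintenance scheduling problem is the variant of the maintenance scheduling problem with train paths in only one direction. The paths $\mathcal P=\{\ell_1,\dots,\ell_m\}$ are equidistant parallel segments ordered in time. Each job $j$ in the set $\mathcal J$ of $n$ jobs is described by integers $r'_j,d'_j,p'_j$ with $1\le r'_j\le d'_j\le m$ and $1\le p'_j\le d'_j-r'_j+1$. Writing $[\ell_a,\ell_b]=\{\ell_a,\ell_{a+1},\dots,\ell_b\}$, the possessions of job $j$ (the sets of paths that can be cancelled by scheduling job $j$) are all blocks of $p'_j$ consecutive paths inside $[\ell_{r'_j},\ell_{d'_j}]$: $$\mathcal R_j=\{[\ell_{r'_j},\ell_{r'_j+p'_j-1}],\,[\ell_{r'_j+1},\ell_{r'_j+p'_j}],\dots,[\ell_{d'_j-p'_j+1},\ell_{d'_j}]\}.$$ A solution selects one possession $R_j\in\mathcal R_j$ for each job $j$, and the objective is to minimise $\left|\bigcup_{j\in\mathcal J}R_j\right|$. Running time counts elementary arithmetic operations on the numbers $m,r'_j,d'_j,p'_j$. *)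

(* Defs.v *)
From mathcomp Require Import all_boot.

Set Implicit Arguments.
Unset Strict Implicit.
Unset Printing Implicit Defensive.

Record instance := Instance {
  njobs : nat;
  npaths : nat;
  release : 'I_njobs -> nat;
  deadline : 'I_njobs -> nat;
  duration : 'I_njobs -> nat;
  _ : forall j,
        [/\ 1 <= release j <= deadline j, deadline j <= npaths
          & 1 <= duration j <= deadline j - release j + 1] }.

(* Paths are numbered from 1, so the i-th element of 'I_m, counted from 0, is
   the path of index i.+1; [block m a b] is the set of paths l_a, ..., l_b. *)
Definition block (m a b : nat) : {set 'I_m} :=
  [set i : 'I_m | a <= i.+1 <= b].

(* The block of [duration j] consecutive paths starting at the path s. *)
Definition block_at (I : instance) (j : 'I_(njobs I)) (s : nat) :
    {set 'I_(npaths I)} :=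
  block (npaths I) s (s + duration j - 1).

Definition possessions (I : instance) (j : 'I_(njobs I)) :
    {set {set 'I_(npaths I)}} :=
  [set block_at j s | s : 'I_(npaths I).+1
                    & release j <= s <= deadline j - duration j + 1].

Definition selection (I : instance) := 'I_(njobs I) -> {set 'I_(npaths I)}.

Definition is_solution (I : instance) (R : selection I) : Prop :=
  forall j, R j \in possessions j.

Definition cost (I : instance) (R : selection I) : nat := #|\bigcup_j R j|.

Definition is_optimal (I : instance) (R : selection I) : Prop :=
  is_solution R /\ forall R' : selection I, is_solution R' -> cost R <= cost R'.

(* Algorithms are programs of a structured random access machine over the
   natural numbers, with finitely many registers per program and an unbounded
   memory. The arithmetic primitives are addition, truncated subtraction and
   comparison; there is no unit-cost multiplication, which on unbounded numbers
   would make unit-cost running times unrealistic. *)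
Inductive expr : Type :=
| Const of nat
| Reg of nat
| Read of expr
| Add of expr & expr
| Sub of expr & expr.

(* The guard of [If a b] and [While a b] is the test a <= b. *)
Inductive cmd : Type :=
| Skip
| Assign of nat & expr
| Store of expr & expr
| Seq of cmd & cmd
| If of expr & expr & cmd & cmd
| While of expr & expr & cmd.

Record state := State { regs : nat -> nat; mem : nat -> nat }.

Definition upd (f : nat -> nat) (x v : nat) : nat -> nat :=
  fun y => if y == x then v else f y.

Fixpoint eval (e : expr) (s : state) : nat :=
  match e with
  | Const k => k
  | Reg x => regs s x
  | Read a => mem s (eval a s)
  | Add a b => eval a s + eval b s
  | Sub a b => eval a s - eval b s
  end.

Fixpoint expr_time (e : expr) : nat :=
  match e with
  | Const _ | Reg _ => 1
  | Read a => (expr_time a).+1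
  | Add a b | Sub a b => (expr_time a + expr_time b).+1
  end.

(* [exec c s s' t]: started in s, the program c halts in s' after t elementary
   operations. *)
Inductive exec : cmd -> state -> state -> nat -> Prop :=
| ExecSkip s : exec Skip s s 1
| ExecAssign x e s :
    exec (Assign x e) s (State (upd (regs s) x (eval e s)) (mem s))
      (expr_time e).+1
| ExecStore a e s :
    exec (Store a e) s (State (regs s) (upd (mem s) (eval a s) (eval e s)))
      (expr_time a + expr_time e).+1
| ExecSeq c1 c2 s s1 s2 t1 t2 :
    exec c1 s s1 t1 -> exec c2 s1 s2 t2 -> exec (Seq c1 c2) s s2 (t1 + t2)
| ExecIfTrue a b c1 c2 s s' t :
    eval a s <= eval b s -> exec c1 s s' t ->
    exec (If a b c1 c2) s s' ((expr_time a + expr_time b).+1 + t)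
| ExecIfFalse a b c1 c2 s s' t :
    ~~ (eval a s <= eval b s) -> exec c2 s s' t ->
    exec (If a b c1 c2) s s' ((expr_time a + expr_time b).+1 + t)
| ExecWhileTrue a b c s s1 s2 t1 t2 :
    eval a s <= eval b s -> exec c s s1 t1 -> exec (While a b c) s1 s2 t2 ->
    exec (While a b c) s s2 ((expr_time a + expr_time b).+1 + t1 + t2)
| ExecWhileFalse a b c s :
    ~~ (eval a s <= eval b s) ->
    exec (While a b c) s s (expr_time a + expr_time b).+1.

(* Input: registers 0 and 1 hold the numbers of jobs and of paths; cells 3j,
   3j+1 and 3j+2 hold the release, deadline and duration of job j, the jobs
   being numbered from 0. Everything else is 0. *)
Definition input (I : instance) : state :=
  State (fun x => nth 0 [:: njobs I; npaths I] x)
        (fun a => if (insub (a %/ 3) : option 'I_(njobs I)) is Some j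
                  then nth 0 [:: release j; deadline j; duration j] (a %% 3)
                  else 0).

(* Output: for each job j, cell j holds the index of the first path of the
   selected possession. *)
Definition output (I : instance) (s : state) : selection I :=
  fun j => block_at j (mem s j).
Arguments output : clear implicits.

(* Main.v *)
Require Import Defs.
From mathcomp Require Import all_boot.
From mathcomp Require Import zify.

(** Job j has earliest start r j, latest start q j = d j - p j + 1 and earliest
    completion c j = r j + p j - 1. For thresholds u and v, call j pending when
    u < c j and q j < v. The algorithm computes, for all relevant u and v, a
    cheapest schedule of the pending jobs.

    Let k be a longest pending job. In a schedule, the maximal run [a, b] of
    cancelled paths around k separates the other jobs: those that start before
    a, those that start after b, and those inside. Shift the jobs that start at
    a to the right by one path, as long as all of them can move: the run loses a
    and gains at most b+1, so the cost does not grow, and the process stops with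
    some job j starting at a = q j ([shift_component], [split_exists]). Let w be
    the largest c i <= b of a pending job i. Pending jobs with q < a lie left of
    the run, those with c > w lie right of it, and the run has length at least
    max (p k, w + 1 - a) ([component_split]). Conversely, for any x and w, every
    pending job with q >= x and c <= w fits into the block of length max (p k, w
    + 1 - x) that starts at x, because no pending job is longer than k
    ([load_merge]). Hence the optimum satisfies

      F(u,v) = min over x < v and w > u
                 of F(u,x) + max (p k, w + 1 - x) + F(w,v),

    with F(u,v) = 0 when nothing is pending. Only the n values of q and the n
    values of c occur as x and w, and a pair of sentinels makes all jobs pending,
    so there are (n+1)^2 states with (n+1)^2 transitions each.

    A schedule is stored for every state, copied job by job from the two states
    that realise the minimum; this costs O(n) per state and avoids any traceback.

    The algorithm is written in a small language of bounded loops, whose meaning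
    is a total function on machine states. A program of this language compiles to
    a machine program whose running time is at most a constant times N ^ depth,
    where N = n + 1 bounds all loop lengths and depth is the nesting of the loops
    ([compile_correct]). So the O(n^4) bound is read off the syntax, and
    correctness ([main_spec]) only concerns the function denoted by the
    program. *)

Set Implicit Arguments.
Unset Strict Implicit.
Unset Printing Implicit Defensive.

(** * Loads of partial schedules *)

Lemma sum_interval m a l :
  \sum_(1 <= t < m.+1) (a <= t < a + l) = minn m.+1 (a + l) - maxn 1 a.
Proof.
elim: m => [|m IH]; first by rewrite big_geq //; lia.
by rewrite big_nat_recr //= IH; lia.
Qed.

Section Scheduling.

Variables (m n : nat) (r q p : nat -> nat).
Hypothesis window : forall j, j < n ->
  [/\ 0 < r j, r j <= q j, 0 < p j & q j + p j <= m.+1].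

Definition ect j := r j + p j - 1.

Definition busy (J : pred nat) (s : nat -> nat) (t : nat) : bool :=
  has (fun j => J j && (s j <= t < s j + p j)) (iota 0 n).

Definition load (J : pred nat) s : nat := \sum_(1 <= t < m.+1) busy J s t.

Definition feasible (J : pred nat) (s : nat -> nat) : Prop :=
  forall j, j < n -> J j -> r j <= s j <= q j.

Definition pending u v : pred nat := fun j => (u < ect j) && (q j < v).

Lemma pendingE u v j : pending u v j = (u < ect j) && (q j < v).
Proof. by []. Qed.

Definition merge x w (s1 s2 : nat -> nat) j :=
  if q j < x then s1 j else if w < ect j then s2 j else maxn x (r j).

Lemma busyP (J : pred nat) s t :
  reflect (exists j, [/\ j < n, J j & s j <= t < s j + p j]) (busy J s t).
Proof.
apply: (iffP hasP) => [[j]|[j [jn Jj tj]]].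
  by rewrite mem_iota /= add0n => jn /andP[Jj tj]; exists j.
by exists j; rewrite ?mem_iota ?Jj.
Qed.

Lemma feasible_sub (J K : pred nat) s :
  (forall j, j < n -> K j -> J j) -> feasible J s -> feasible K s.
Proof. by move=> KJ fJ j jn /KJ Jj; apply: fJ => //; apply: Jj. Qed.

Lemma load_le (J : pred nat) s : load J s <= m.
Proof.
apply: leq_trans (_ : \sum_(1 <= t < m.+1) 1 <= _).
  by apply: leq_sum => t _; apply: leq_b1.
by rewrite sum_nat_const_nat; lia.
Qed.

Lemma load_eq (J J' : pred nat) s s' :
  (forall j, j < n -> J j = J' j) -> (forall j, j < n -> J j -> s j = s' j) ->
  load J s = load J' s'.
Proof.
move=> eJ es; apply: eq_bigr => t _; congr nat_of_bool.
apply: eq_in_has => j; rewrite mem_iota /= add0n => jn.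
by rewrite -eJ //; case Jj: (J j) => //=; rewrite es.
Qed.

Lemma load_pending0 u v s :
  (forall j, j < n -> ~~ pending u v j) -> load (pending u v) s = 0.
Proof.
move=> no; rewrite /load big1 // => t _; case: busyP => // -[j [/no /negP]] //.
Qed.

Lemma feasible_merge u v x w s1 s2 :
  feasible (pending u x) s1 -> feasible (pending w v) s2 ->
  feasible (pending u v) (merge x w s1 s2).
Proof.
move=> f1 f2 j jn /andP[uj jv]; rewrite /merge.
case: ifP => qx; first by apply: f1 => //; rewrite /pending uj.
case: ifP => wc; first by apply: f2 => //; rewrite /pending wc.
by case: (window jn); lia.
Qed.

(** A job of the middle block starts at x or at its release date: in the first
    case it ends by x + P - 1, in the second case by its earliest completion,
    which is at most w. *)
Lemma load_merge u v x w P s1 s2 :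
    (forall j, j < n -> pending u v j -> p j <= P) ->
  load (pending u v) (merge x w s1 s2) <=
    load (pending u x) s1 + maxn P (w.+1 - x) + load (pending w v) s2.
Proof.
move=> pP.
have len : \sum_(1 <= t < m.+1) (x <= t < x + maxn P (w.+1 - x)) <=
    maxn P (w.+1 - x) by rewrite sum_interval; lia.
apply: leq_trans (leq_add (leq_add (leqnn _) len) (leqnn _)).
rewrite -!big_split /=; apply: leq_sum => t _.
case: (busyP _ (merge _ _ _ _)) => // -[j [jn Jj]]; rewrite /merge.
have [uj jv] := andP Jj; have {}pP := pP j jn Jj; have [r0 rq p0 _] := window jn.
case: ifP => qx tj.
  suff -> : busy (pending u x) s1 t by lia.
  by apply/busyP; exists j; rewrite /pending uj.
move: tj; case: ifP => wc tj.
  suff -> : busy (pending w v) s2 t by lia.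
  by apply/busyP; exists j; rewrite /pending wc.
suff -> : x <= t < x + maxn P (w.+1 - x) by lia.
by move: wc; rewrite /ect; lia.
Qed.

Lemma busy_range (J : pred nat) s t : feasible J s -> busy J s t -> 0 < t <= m.
Proof.
move=> f /busyP[j [jn Jj tj]]; have := f j jn Jj; have := window jn.
by case; lia.
Qed.

(** Both ends exist because only paths from 1 to m can be busy; in particular
    the paths 0 and m+1 are not. *)
Lemma busy_component (J : pred nat) s t0 : feasible J s -> busy J s t0 ->
  exists a b, [/\ a <= t0 <= b, forall t, a <= t <= b -> busy J s t,
    0 < a, ~~ busy J s a.-1 & ~~ busy J s b.+1].
Proof.
move=> f bt0; have bm t := @busy_range J s t f.
pose A a := all (busy J s) (index_iota a t0.+1).
have AP a : A a <-> forall t, a <= t <= t0 -> busy J s t.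
  split=> [/allP h t tr|h]; first by apply: h; rewrite mem_index_iota; lia.
  by apply/allP => t; rewrite mem_index_iota => tr; apply: h; lia.
have exA : exists a, A a.
  by exists t0; apply/AP => t tt; have -> : t = t0 by lia.
pose B b := all (busy J s) (index_iota t0 b.+1) && (b <= m).
have BP b : B b <-> (forall t, t0 <= t <= b -> busy J s t) /\ b <= m.
  split=> [/andP[/allP h ->]|[h bm']].
    by split=> // t tr; apply: h; rewrite mem_index_iota; lia.
  by rewrite /B bm' andbT; apply/allP => t; rewrite mem_index_iota => tr; apply: h; lia.
have exB : exists b, B b.
  exists t0; apply/BP; split=> [t tt|]; first by have -> : t = t0 by lia.
  by have := bm _ bt0; lia.
have bdB b : B b -> b <= m by case/andP.
case: (ex_minnP exA) => a /AP Aa amin; case: (ex_maxnP exB bdB) => b /BP[Bb b_m] bmax.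
have at0 : a <= t0 by apply: amin; apply/AP => t tt; have -> : t = t0 by lia.
have t0b : t0 <= b.
  apply: bmax; apply/BP; split=> [t tt|]; first by have -> : t = t0 by lia.
  by have := bm _ bt0; lia.
have a0 : 0 < a by have := bm _ (Aa a _); lia.
exists a, b; split; first by lia.
- move=> t tab; case: (leqP t t0) => tt; [apply: Aa | apply: Bb]; lia.
- by [].
- apply/negP => ba; suff : a <= a.-1 by lia.
  apply: amin; apply/AP => t tt; case: (ltnP t a) => ta; last by apply: Aa; lia.
  by have -> : t = a.-1 by lia.
- apply/negP => bb; suff : b.+1 <= b by lia.
  apply: bmax; apply/BP; split; last by have := bm _ bb; lia.
  move=> t tt; case: (leqP t b) => tb; first by apply: Bb; lia.
  by have -> : t = b.+1 by lia.
Qed.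

(** The jobs left and right of a maximal run never share a path with it, since a
    job covering one of its ends from outside would extend it. Taking for [ect j]
    the largest earliest completion up to b, the jobs beyond [ect j] complete
    after b in every schedule. *)
Lemma component_split u v s k a b :
    feasible (pending u v) s -> k < n -> pending u v k ->
    (forall j, j < n -> pending u v j -> p j <= p k) ->
    a <= s k <= b -> (forall t, a <= t <= b -> busy (pending u v) s t) ->
    0 < a -> ~~ busy (pending u v) s a.-1 -> ~~ busy (pending u v) s b.+1 ->
    a <= v ->
  exists2 j, j < n & pending u v j /\
    load (pending u a) s + maxn (p k) ((ect j).+1 - a) + load (pending (ect j) v) s
      <= load (pending u v) s.
Proof.
move=> f kn Jk pk sk full a0 na nb av.
have [r0k rqk p0k qmk] := window kn; have fk := f k kn Jk.
have kb : s k + p k <= b.+1.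
  case: (leqP (s k + p k) b.+1) => // lt; case/negP: nb.
  by apply/busyP; exists k; split=> //; lia.
have bm : b <= m.
  have : busy (pending u v) s b by apply: full; lia.
  by move/(busy_range f); lia.
pose D := [pred i : 'I_n | pending u v i && (ect i <= b)].
have Dk : D (Ordinal kn) by rewrite /= Jk /ect; lia.
case: (arg_maxnP (fun i : 'I_n => ect i) Dk) => j /andP[Jj jb] jmax.
exists j => //; split=> //.
(* The run contains job k and reaches up to the completion time [ect j]. *)
have len : maxn (p k) ((ect j).+1 - a) <= b.+1 - a by lia.
apply: leq_trans (leq_add (leq_add (leqnn _) len) (leqnn _)) _.
have -> : b.+1 - a = \sum_(1 <= t < m.+1) (a <= t < a + (b.+1 - a)).
  by rewrite sum_interval; lia.
rewrite -!big_split /=; apply: leq_sum => t _.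
have [c1|c1] := boolP (busy (pending u a) s t).
  have /busyP[i [ni /andP[ui qa] ti]] := c1.
  have Ji : pending u v i by rewrite /pending ui; lia.
  have fi := f i ni Ji.
  have -> : busy (pending u v) s t by apply/busyP; exists i.
  have ta : t < a.-1.
    case: (ltnP t a.-1) => // ta; case/negP: na.
    by apply/busyP; exists i; split=> //; lia.
  have -> : busy (pending (ect j) v) s t = false.
    apply/negP => /busyP[i' [ni' /andP[ui' qa'] ti']].
    have Ji' : pending u v i' by rewrite /pending qa'; case/andP: Jj; lia.
    have := jmax (Ordinal ni'); rewrite /D /= Ji' /= => jm.
    have fi' := f i' ni' Ji'.
    case/negP: na; apply/busyP; exists i'; split=> //.
    by move: jm ui' fi'; rewrite /ect; lia.
  by lia.
have [c2|c2] := boolP (busy (pending (ect j) v) s t).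
  have /busyP[i [ni /andP[ui qv] ti]] := c2.
  have Ji : pending u v i by rewrite /pending qv; case/andP: Jj; lia.
  have -> : busy (pending u v) s t by apply/busyP; exists i.
  have fi := f i ni Ji.
  have ib : b < ect i.
    case: (ltnP b (ect i)) => // ib.
    by have := jmax (Ordinal ni); rewrite /D /= Ji ib => /(_ isT) /=; lia.
  have ti' : b.+1 < s i.
    case: (ltnP b.+1 (s i)) => // ta; case/negP: nb.
    by apply/busyP; exists i; split=> //; move: ib; rewrite /ect; lia.
  by lia.
case: (boolP (a <= t < a + (b.+1 - a))) => // tab.
by rewrite full; lia.
Qed.

(** A job that starts before a and covers a path of the run would also cover a-1.
    So after moving the jobs that start at a, path a is free, and only b+1 can be
    newly covered. *)
Lemma shift_component (J : pred nat) s a b :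
    feasible J s -> a <= b ->
    (forall t, a <= t <= b -> busy J s t) ->
    0 < a -> ~~ busy J s a.-1 -> ~~ busy J s b.+1 ->
    (forall j, j < n -> J j -> s j = a -> a < q j) ->
  let s' := fun j => if J j && (s j == a) then a.+1 else s j in
  feasible J s' /\ load J s' <= load J s.
Proof.
move=> f ab full a0 na nb late s'; split.
  move=> j jn Jj; rewrite /s' Jj /=; have fj := f j jn Jj.
  by case: eqP => [e|//]; have := late j jn Jj e; lia.
have am : a <= m.
  have : busy J s a by apply: full; lia.
  by move/(busy_range f); lia.
have unit c : \sum_(1 <= t < m.+1) (t == c) = minn m.+1 c.+1 - maxn 1 c.
  rewrite -(addn1 c) -(sum_interval m c 1); apply: eq_bigr => t _; congr nat_of_bool; lia.
have sa : \sum_(1 <= t < m.+1) (t == a) = 1 by rewrite unit; lia.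
have sb : \sum_(1 <= t < m.+1) (t == b.+1) <= 1 by rewrite unit; lia.
(* Compared path by path, with a and b+1 accounted for separately. *)
suff : load J s' + \sum_(1 <= t < m.+1) (t == a) <=
       load J s + \sum_(1 <= t < m.+1) (t == b.+1) by lia.
rewrite -!big_split /=; apply: leq_sum => t _.
case: (busyP J s') => [[j [jn Jj]]|_]; last first.
  by case: eqP => // ->; rewrite full; lia.
rewrite /s' Jj /=; case: eqP => [sj|sj] tj; last first.
  have -> : busy J s t by apply/busyP; exists j.
  have ta : t <> a.
    move=> ta; case/negP: na; apply/busyP; exists j; split=> //; lia.
  by lia.
have jb : a + p j <= b.+1.
  case: (leqP (a + p j) b.+1) => // lt; case/negP: nb.
  by apply/busyP; exists j; split=> //; lia.
case: (leqP t b) => tb; last by lia.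
by rewrite full; lia.
Qed.

(** Shifting a component makes the starts grow, so it can be repeated only
    finitely often; the sum of m + 2 - s j is the decreasing measure. *)
Lemma split_exists u v s k :
    feasible (pending u v) s -> k < n -> pending u v k ->
    (forall j, j < n -> pending u v j -> p j <= p k) ->
  exists s' i j, [/\ i < n /\ pending u v i, j < n /\ pending u v j,
      feasible (pending u v) s' &
    load (pending u (q i)) s' + maxn (p k) ((ect j).+1 - q i)
      + load (pending (ect j) v) s' <= load (pending u v) s].
Proof.
move=> + kn Jk pk.
have [N] := ubnP (\sum_(j <- iota 0 n) (m.+2 - s j)).
elim: N s => // N IH s sN f.
have [_ _ p0k _] := window kn.
have bk : busy (pending u v) s (s k).
  by apply/busyP; exists k; split=> //; lia.
have [a [b [skab full a0 na nb]]] := busy_component f bk.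
have start j : j < n -> pending u v j -> s j <= a < s j + p j -> s j = a.
  move=> jn Jj aj; case: (ltnP (s j) a) => sa; last by lia.
  by case/negP: na; apply/busyP; exists j; split=> //; lia.
have [/hasP[i]|] := boolP (has (fun j => [&& pending u v j, s j == a & q j == a]) (iota 0 n)).
  rewrite mem_iota add0n /= => i_n /and3P[Ji /eqP sa /eqP qa].
  have av : a <= v by move: Ji; rewrite /pending; lia.
  have [j jn [Jj le]] := component_split f kn Jk pk skab full a0 na nb av.
  by exists s, i, j; split=> //; rewrite qa.
move/hasPn => none.
have late j : j < n -> pending u v j -> s j = a -> a < q j.
  move=> jn Jj sj; have := none j; rewrite mem_iota add0n jn => /(_ isT).
  by rewrite Jj sj eqxx /=; have := f j jn Jj; lia.
have ab : a <= b by lia.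
have [f' le] := shift_component f ab full a0 na nb late.
have [|s' [i [j [Pi Pj fs' le']]]] := IH _ _ f'; last first.
  by exists s', i, j; split=> //; apply: leq_trans le' _.
have [j [jn Jj /start sj]] : exists j, [/\ j < n, pending u v j & s j <= a < s j + p j].
  by apply/busyP; apply: full; lia.
rewrite ltnS in sN; apply: leq_trans sN.
have jin : j \in iota 0 n by rewrite mem_iota.
rewrite (bigD1_seq j) ?iota_uniq //= [X in _ < X](bigD1_seq j) ?iota_uniq //=.
have {}sj := sj jn Jj; rewrite Jj sj eqxx /=.
have am : a <= m by have := late j jn Jj sj; have := window jn; case; lia.
rewrite -addSn; apply: leq_add; first by lia.
by apply: leq_sum => i _; case: ifP => // /andP[_ /eqP]; lia.
Qed.

End Scheduling.

(** * Sorted threshold values *)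

Section Levels.

Variables (m n : nat) (key : nat -> nat).
Hypothesis key_range : forall j, j < n -> 0 < key j <= m.

(** The least key above t among the first i keys, with the sentinel m+1 if there
    is none; the recursion is the linear scan that the program performs. *)
Fixpoint next_key i t : nat :=
  if i is i'.+1 then
    let b := next_key i' t in if (t < key i') && (key i' < b) then key i' else b
  else m.+1.

Definition level k := iter k.+1 (next_key n) 0.

Lemma next_key_ge i t : i <= n -> t <= m.+1 -> t <= next_key i t <= m.+1.
Proof.
elim: i => [|i IH] le tm /=; first by lia.
have := IH (ltnW le) tm; have := key_range le; case: ifP; lia.
Qed.

Lemma next_key_gt i t : i <= n -> t <= m -> t < next_key i t.
Proof.
elim: i => [|i IH] le tm /=; first by lia.
have := IH (ltnW le) tm; have := key_range le; case: ifP; lia.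
Qed.

Lemma next_key_le i j t : j < i -> t < key j -> next_key i t <= key j.
Proof.
elim: i => // i IH ji tj /=.
case: (ltnP j i) => [/IH /(_ tj)|ij]; first by case: ifP; lia.
have -> : i = j by lia.
by case: ifP; lia.
Qed.

Lemma next_key_mem i t :
  next_key i t = m.+1 \/ exists2 j, j < i & next_key i t = key j.
Proof.
elim: i => [|i IH] /=; first by left.
case: ifP => _; first by right; exists i.
by case: IH => [->|[j ji ->]]; [left | right; exists j => //; lia].
Qed.

Lemma level_bound k : level k <= m.+1.
Proof.
elim: k => [|k IH]; rewrite /level iterS.
  by have /andP[] := next_key_ge (leqnn n) (leq0n m.+1).
by have /andP[] := next_key_ge (leqnn n) IH.
Qed.

Lemma level_mono : {homo level : k k' / k <= k'}.
Proof.
apply: homo_leq => // [y x z|k]; first exact: leq_trans.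
by rewrite /level [X in _ <= X]iterS; case/andP: (next_key_ge (leqnn n) (level_bound k)).
Qed.

Lemma level_lt_index k k' : level k < level k' -> k < k'.
Proof. by case: (ltnP k k') => // /level_mono; lia. Qed.

(** Before reaching the sentinel, [level] is strictly increasing through values
    of the n keys, so it cannot do this n+1 times. *)
Lemma level_last : level n = m.+1.
Proof.
apply/eqP; rewrite eqn_leq level_bound ltnNge; apply/negP => ln.
have lt k : k <= n -> level k <= m by move/level_mono; lia.
have mono : {in iota 0 n.+1 &, injective level}.
  move=> k k'; rewrite !mem_iota !add0n !ltnS !leq0n /= => kn kn' e.
  have step i : i < n -> level i < level i.+1.
    by move=> i_n; rewrite {2}/level iterS next_key_gt // lt // ltnW.
  case: (ltngtP k k') => // h; [have /level_mono := h | have /level_mono := h];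
    [have := step k | have := step k']; lia.
have : size (map level (iota 0 n.+1)) <= size (map key (iota 0 n)).
  apply: uniq_leq_size; first by rewrite map_inj_in_uniq ?iota_uniq.
  move=> _ /mapP[k + ->]; rewrite mem_iota add0n ltnS leq0n /= => kn.
  have := lt k kn; rewrite /level iterS.
  by case: (next_key_mem n (iter k (next_key n) 0)) => [->|[j jn ->] _];
    [lia | apply: map_f; rewrite mem_iota].
by rewrite !size_map !size_iota ltnn.
Qed.

Lemma level_surj j : j < n -> exists2 k, k <= n & level k = key j.
Proof.
move=> jn; have kj := key_range jn.
have ex : exists k, key j <= level k by exists n; rewrite level_last; lia.
case: (ex_minnP ex) => k kk kmin; exists k.
  by apply: kmin; rewrite level_last; lia.
apply/eqP; rewrite eqn_leq kk andbT /level iterS.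
apply: next_key_le => //.
case: k kk kmin => [|k] kk kmin; first by move: kj => /=; lia.
rewrite ltnNge; apply/negP => h.
by have := kmin k h; lia.
Qed.

End Levels.

(** * A language of bounded loops, compiled to the machine *)

Local Notation mem := Defs.mem.

(* The registers up to R_base describe the instance and stay constant; R_base
   is 3n, the first cell above the input, and R_size is n + 1. The state of the
   dynamic program under treatment is (R_u, R_v), with threshold values R_after
   and R_before; transitions are tried through (R_tryu, R_tryv), and the best one
   is kept in (R_bestu, R_bestv). *)
Local Notation R_n := 0 (only parsing).
Local Notation R_m := 1 (only parsing).
Local Notation R_size := 2 (only parsing).
Local Notation R_base := 3 (only parsing).
Local Notation R_cur := 4 (only parsing).
Local Notation R_acc := 5 (only parsing).
Local Notation R_row := 6 (only parsing).
Local Notation R_col := 7 (only parsing).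
Local Notation R_v := 8 (only parsing).
Local Notation R_u := 9 (only parsing).
Local Notation R_longest := 10 (only parsing).
Local Notation R_best := 11 (only parsing).
Local Notation R_bestv := 12 (only parsing).
Local Notation R_bestu := 13 (only parsing).
Local Notation R_tryv := 14 (only parsing).
Local Notation R_tryu := 15 (only parsing).
Local Notation R_job := 16 (only parsing).
Local Notation R_cost := 17 (only parsing).
Local Notation R_after := 18 (only parsing).
Local Notation R_before := 19 (only parsing).
Local Notation T_mult := 0 (only parsing).
Local Notation T_latest := 1 (only parsing).
Local Notation T_ect := 2 (only parsing).
Local Notation T_cost := 3 (only parsing).
Local Notation T_start := 4 (only parsing).

(** [LFor r x c] runs c with register x counting from 0 up to the value of
    register r. *)
Inductive loop : Type :=
| LSkip
| LAssign of nat & expr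
| LStore of expr & expr
| LSeq of loop & loop
| LIf of expr & expr & loop & loop
| LFor of nat & nat & loop.

Local Infix ";;" := LSeq (at level 90, right associativity).

Definition setreg x v (s : state) := State (upd (regs s) x v) (mem s).
Definition setmem a v (s : state) := State (regs s) (upd (mem s) a v).

Lemma regs_setreg x v s y : regs (setreg x v s) y = if y == x then v else regs s y.
Proof. by []. Qed.

Fixpoint compile (c : loop) : cmd :=
  match c with
  | LSkip => Skip
  | LAssign x e => Assign x e
  | LStore a e => Store a e
  | LSeq c1 c2 => Seq (compile c1) (compile c2)
  | LIf a b c1 c2 => If a b (compile c1) (compile c2)
  | LFor r x c =>
      Seq (Assign x (Const 0))
        (While (Add (Reg x) (Const 1)) (Reg r)
          (Seq (compile c) (Assign x (Add (Reg x) (Const 1)))))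
  end.

Fixpoint den (c : loop) (s : state) : state :=
  match c with
  | LSkip => s
  | LAssign x e => setreg x (eval e s) s
  | LStore a e => setmem (eval a s) (eval e s) s
  | LSeq c1 c2 => den c2 (den c1 s)
  | LIf a b c1 c2 => if eval a s <= eval b s then den c1 s else den c2 s
  | LFor r x c =>
      iter (regs s r) (fun s => setreg x (regs (den c s) x + 1) (den c s))
        (setreg x 0 s)
  end.

Fixpoint writes (c : loop) : seq nat :=
  match c with
  | LSkip | LStore _ _ => [::]
  | LAssign x _ => [:: x]
  | LSeq c1 c2 | LIf _ _ c1 c2 => writes c1 ++ writes c2
  | LFor _ x c => x :: writes c
  end.

Fixpoint storeless (c : loop) : bool :=
  match c with
  | LSkip | LAssign _ _ => true
  | LStore _ _ => false
  | LSeq c1 c2 | LIf _ _ c1 c2 => storeless c1 && storeless c2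
  | LFor _ _ c => storeless c
  end.

(** A loop is only allowed to run n or n+1 times and may not modify its counter,
    so the number of iterations is known on entry. *)
Fixpoint well_formed (c : loop) : bool :=
  match c with
  | LSkip | LStore _ _ => true
  | LAssign x _ => R_base < x
  | LSeq c1 c2 | LIf _ _ c1 c2 => well_formed c1 && well_formed c2
  | LFor r x c => [&& (r == R_n) || (r == R_size), R_base < x, x \notin writes c & well_formed c]
  end.

Fixpoint depth (c : loop) : nat :=
  match c with
  | LSkip | LAssign _ _ | LStore _ _ => 0
  | LSeq c1 c2 | LIf _ _ c1 c2 => maxn (depth c1) (depth c2)
  | LFor _ _ c => (depth c).+1
  end.

(** With [depth], this bounds the running time by a polynomial in N without
    executing the program. The 16 steps of overhead of a loop are 9 for testing
    and advancing the counter in each iteration, and 7 for initialising it and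
    for the last test. *)
Fixpoint factor (c : loop) : nat :=
  match c with
  | LSkip => 1
  | LAssign _ e => (expr_time e).+1
  | LStore a e => (expr_time a + expr_time e).+1
  | LSeq c1 c2 => factor c1 + factor c2
  | LIf a b c1 c2 => (expr_time a + expr_time b).+1 + (factor c1 + factor c2)
  | LFor _ _ c => 16 + factor c
  end.

Lemma den_frame c s y : y \notin writes c -> regs (den c s) y = regs s y.
Proof.
elim: c s => [|x e|a e|c1 IH1 c2 IH2|a b c1 IH1 c2 IH2|r x c IH] s //=.
- by rewrite inE /upd => /negPf ->.
- by rewrite mem_cat negb_or => /andP[w1 w2]; rewrite IH2 ?IH1.
- by rewrite mem_cat negb_or => /andP[w1 w2]; case: ifP => _; rewrite ?IH1 ?IH2.
rewrite inE negb_or => /andP[/negPf yx w].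
by elim: (regs s r) => [|k IHk] /=; rewrite /upd yx ?IH.
Qed.

Lemma den_storeless c s : storeless c -> mem (den c s) = mem s.
Proof.
elim: c s => [|x e|a e|c1 IH1 c2 IH2|a b c1 IH1 c2 IH2|r x c IH] s //=.
- by case/andP=> w1 w2; rewrite IH2 ?IH1.
- by case/andP=> w1 w2; case: ifP => _; rewrite ?IH1 ?IH2.
by move=> w; elim: (regs s r) => [|k IHk] //=; rewrite IH.
Qed.

Lemma well_formed_writes c y : well_formed c -> y < 4 -> y \notin writes c.
Proof.
move=> + y4; elim: c => [|x e|a e|c1 IH1 c2 IH2|a b c1 IH1 c2 IH2|r x c IH] //=.
- by rewrite inE; lia.
- by rewrite mem_cat negb_or => /andP[/IH1 -> /IH2 ->].
- by rewrite mem_cat negb_or => /andP[/IH1 -> /IH2 ->].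
by rewrite inE negb_or => /and4P[_ x3 _ /IH ->]; rewrite andbT; lia.
Qed.

(** The frame conditions are handed to the proof of the invariant step, so that
    an invariant only has to mention what the loop body changes. *)
Lemma den_for (I : nat -> state -> Prop) r x c s :
    well_formed (LFor r x c) -> I 0 (setreg x 0 s) ->
    (forall i s', i < regs s r -> regs s' x = i ->
       (forall y, y \notin x :: writes c -> regs s' y = regs s y) ->
       (storeless c -> mem s' = mem s) ->
       I i s' -> I i.+1 (setreg x i.+1 (den c s'))) ->
  I (regs s r) (den (LFor r x c) s).
Proof.
move=> /and4P[_ _ xc wc] I0 IS /=.
suff H k : k <= regs s r -> let s' := iter k (fun s => setreg x (regs (den c s) x + 1) (den c s))
        (setreg x 0 s) in [/\ I k s', regs s' x = k,
     forall y, y \notin x :: writes c -> regs s' y = regs s y &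
     storeless c -> mem s' = mem s].
  by have [] := H (regs s r) (leqnn _).
elim: k => [|k IH] kr; cbv zeta; last rewrite iterS.
  split=> //=; first by rewrite /upd eqxx.
  by move=> y; rewrite inE negb_or /= /upd => /andP[/negPf ->].
have [Ik xk fr st] := IH (ltnW kr); set s' := iter _ _ _ in Ik xk fr st *.
have e : regs (den c s') x + 1 = k.+1 by rewrite den_frame // xk addn1.
rewrite e; split.
- exact: IS.
- by rewrite regs_setreg eqxx.
- move=> y ym; rewrite regs_setreg; move: (ym); rewrite inE negb_or => /andP[/negPf -> yc].
  by rewrite den_frame // fr.
- by move=> sc; rewrite /= den_storeless // st.
Qed.

Lemma compile_correct c s N :
    well_formed c -> 0 < N -> regs s R_n <= N -> regs s R_size <= N ->
  exists2 t, exec (compile c) s (den c s) t & t <= factor c * N ^ depth c.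
Proof.
move=> + N0; have pow i j : i <= j -> N ^ i <= N ^ j by apply: leq_pexp2l.
elim: c s => [|x e|a e|c1 IH1 c2 IH2|a b c1 IH1 c2 IH2|r x c IH] s /=.
- by exists 1; [constructor|].
- by exists (expr_time e).+1; [constructor | rewrite expn0; lia].
- by exists (expr_time a + expr_time e).+1; [constructor | rewrite expn0; lia].
- case/andP=> w1 w2 s0 s2; have [t1 e1 le1] := IH1 s w1 s0 s2.
  have [||t2 e2 le2] := IH2 (den c1 s) w2; try by rewrite den_frame // well_formed_writes.
  exists (t1 + t2); first by econstructor; eauto.
  have := pow _ _ (leq_maxl (depth c1) (depth c2)).
  have := pow _ _ (leq_maxr (depth c1) (depth c2)).
  by nia.
- case/andP=> w1 w2 s0 s2.
  have P0 : 0 < N ^ maxn (depth c1) (depth c2) by rewrite expn_gt0 N0.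
  have p1 := pow _ _ (leq_maxl (depth c1) (depth c2)).
  have p2 := pow _ _ (leq_maxr (depth c1) (depth c2)).
  case: (boolP (eval a s <= eval b s)) => g.
    have [t1 e1 le1] := IH1 s w1 s0 s2.
    exists ((expr_time a + expr_time b).+1 + t1); first exact: ExecIfTrue.
    by nia.
  have [t2 e2 le2] := IH2 s w2 s0 s2.
  exists ((expr_time a + expr_time b).+1 + t2); first exact: ExecIfFalse.
  by nia.
case/and4P=> r02 x3 xc wc s0 s2.
have rN : regs s r <= N by case/orP: r02 => /eqP ->.
have xr : x <> r by case/orP: r02 => /eqP; lia.
pose step s := setreg x (regs (den c s) x + 1) (den c s).
pose W := While (Add (Reg x) (Const 1)) (Reg r)
          (Seq (compile c) (Assign x (Add (Reg x) (Const 1)))).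
have loop k s' : k + regs s' x = regs s' r -> k <= N -> regs s' R_n <= N -> regs s' R_size <= N ->
    exists2 t, exec W s' (iter k step s') t &
      t <= 5 + k * (9 + factor c * N ^ depth c).
  elim: k s' => [|k IHk] s' ks kN s0' s2'.
    exists 5; last by lia.
    by apply: ExecWhileFalse => /=; lia.
  have [t1 e1 le1] := IH s' wc s0' s2'.
  have fr y : y < 4 -> regs (step s') y = regs s' y.
    by move=> y4; rewrite /step regs_setreg; case: eqP => [|_]; [lia | rewrite den_frame // well_formed_writes].
  have rr : regs (step s') r = regs s' r by apply: fr; case/orP: r02 => /eqP ->.
  have rx : regs (step s') x = regs s' x + 1.
    by rewrite /step regs_setreg eqxx den_frame.
  have [|||| t2 e2 le2] := IHk (step s').
  - by rewrite rr rx; lia.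
  - by lia.
  - by rewrite fr.
  - by rewrite fr.
  exists (5 + (t1 + 4) + t2).
    rewrite iterSr; apply: ExecWhileTrue e2; first by rewrite /=; lia.
    apply: ExecSeq e1 _; exact: (ExecAssign x (Add (Reg x) (Const 1))).
  by nia.
have set0 y : regs (setreg x 0 s) y = if y == x then 0 else regs s y by [].
have [|||| t e le] := loop (regs s r) (setreg x 0 s).
- by rewrite !set0 eqxx; case: eqP => [/esym|] //; lia.
- by [].
- by rewrite set0; case: ifP.
- by rewrite set0; case: ifP.
exists (2 + t); first by apply: ExecSeq e; apply: ExecAssign.
have P0 : 0 < N ^ depth c by rewrite expn_gt0 N0.
rewrite expnS; set Q := N ^ _ in le P0 *; set f := factor c in le *.
apply: leq_trans (_ : 7 + N * (9 + f * Q) <= _); first by nia.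
by nia.
Qed.

(** * The dynamic program *)

(** The five arrays are interleaved above the input: entry i of array t lies at
    offset 5i + t. They are then disjoint whatever their lengths are. *)
Definition At (t : nat) (e : expr) : expr :=
  Add (Reg R_base) (Add (Const t) (Add e (Add e (Add e (Add e e))))).
Definition Get t e := Read (At t e).
(** There is no multiplication: the entry (i, j) of a matrix has index
    i * (n+1) + j, and the multiple of n+1 is read from a table. *)
Definition Flat e f := Add (Get T_mult e) f.
Definition Datum (i : nat) (j : expr) := Read (Add (Add j (Add j j)) (Const i)).
Definition Latest j := Defs.Sub (Add (Datum 1 j) (Const 1)) (Datum 2 j).
Definition Ect j := Defs.Sub (Add (Datum 0 j) (Datum 2 j)) (Const 1).
Definition Max e f := Add e (Defs.Sub f e).
Definition When a b c := LIf a b c LSkip.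
Definition Lt a b c := When (Add a (Const 1)) b c.

(** All multiples i * (n+1) for i < (n+1)^2, so that [Flat] can be nested for
   three-dimensional arrays. *)
Definition table_prog :=
  LAssign R_cur (Const 0);; LAssign R_acc (Const 0);;
  LFor R_size R_row (LFor R_size R_col
    (LStore (At T_mult (Reg R_cur)) (Reg R_acc);;
     LAssign R_cur (Add (Reg R_cur) (Const 1));;
     LAssign R_acc (Add (Reg R_acc) (Reg R_size)))).

Definition next_prog key :=
  LAssign R_acc (Add (Reg R_m) (Const 1));;
  LFor R_n R_col (Lt (Reg R_cur) key (Lt key (Reg R_acc) (LAssign R_acc key))).

(** Repeated extraction of the next larger key; quadratic, but below the cost of
   the main loops. *)
Definition levels_prog t key out :=
  LAssign R_cur (Const 0);;
  LFor R_size R_row (next_prog key;; LAssign R_cur (Reg R_acc);; LStore (At t (Reg R_row)) out).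

Definition longest_prog :=
  LAssign R_longest (Const 0);;
  LFor R_n R_job (Lt (Reg R_after) (Ect (Reg R_job)) (Lt (Latest (Reg R_job)) (Reg R_before)
    (Lt (Reg R_longest) (Datum 2 (Reg R_job)) (LAssign R_longest (Datum 2 (Reg R_job)))))).

Definition try_prog :=
  LAssign R_cost
    (Add (Add (Get T_cost (Flat (Reg R_u) (Reg R_tryv)))
              (Max (Reg R_longest) (Defs.Sub (Add (Get T_ect (Reg R_tryu)) (Const 1)) (Get T_latest (Reg R_tryv)))))
         (Get T_cost (Flat (Reg R_tryu) (Reg R_v))));;
  Lt (Reg R_cost) (Reg R_best)
    (LAssign R_best (Reg R_cost);; LAssign R_bestv (Reg R_tryv);; LAssign R_bestu (Reg R_tryu)).

Definition best_prog :=
  LIf (Reg R_longest) (Const 0) (LAssign R_best (Const 0)) (LAssign R_best (Add (Reg R_m) (Const 1)));;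
  LAssign R_bestv (Const 0);; LAssign R_bestu (Const 0);;
  LFor R_size R_tryv (Lt (Reg R_tryv) (Reg R_v) (LFor R_size R_tryu (Lt (Reg R_tryu) (Reg R_u) try_prog))).

Definition start_at l k := At T_start (Flat (Flat l k) (Reg R_job)).

(** The start of each job is inherited from the left or the right state of the
   best transition, or lies in the block between them. *)
Definition copy_prog :=
  LFor R_n R_job
    (LIf (Add (Latest (Reg R_job)) (Const 1)) (Get T_latest (Reg R_bestv))
       (LStore (start_at (Reg R_u) (Reg R_v)) (Read (start_at (Reg R_u) (Reg R_bestv))))
    (LIf (Add (Get T_ect (Reg R_bestu)) (Const 1)) (Ect (Reg R_job))
       (LStore (start_at (Reg R_u) (Reg R_v)) (Read (start_at (Reg R_bestu) (Reg R_v))))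
       (LStore (start_at (Reg R_u) (Reg R_v)) (Max (Get T_latest (Reg R_bestv)) (Datum 0 (Reg R_job)))))).

Definition cell_prog :=
  LAssign R_after (Get T_ect (Reg R_u));; LAssign R_before (Get T_latest (Reg R_v));;
  longest_prog;; best_prog;;
  LStore (At T_cost (Flat (Reg R_u) (Reg R_v))) (Reg R_best);;
  copy_prog.

Definition output_prog :=
  LFor R_n R_job (LStore (Reg R_job) (Read (start_at (Reg R_n) (Reg R_n)))).

(** The earliest completions are needed in decreasing order; reversing time turns
   them into the increasing keys m + 1 - c. *)
Definition main_prog :=
  table_prog;;
  levels_prog T_latest (Latest (Reg R_col)) (Reg R_acc);;
  levels_prog T_ect (Defs.Sub (Add (Reg R_m) (Const 1)) (Ect (Reg R_col)))
    (Defs.Sub (Add (Reg R_m) (Const 1)) (Reg R_acc));;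
  LFor R_size R_v (LFor R_size R_u cell_prog);;
  output_prog.

Lemma main_well_formed : well_formed main_prog.
Proof. by []. Qed.
Lemma main_depth : depth main_prog = 4.
Proof. by []. Qed.

Section Correctness.

Variables (m n : nat) (r d p : nat -> nat).
Let q j := d j + 1 - p j.
Hypothesis window : forall j, j < n ->
  [/\ 0 < r j, r j <= q j, 0 < p j & q j + p j <= m.+1].
Notation N := n.+1.
Notation c := (ect r p).
Notation pending := (pending r q p).
Notation V := (level m n q).
(** Nonincreasing in l and equal to 0 for l = n, whereas [V] is nondecreasing and
    equal to m + 1 for the index n; so the state (n, n) comprises all jobs. *)
Definition U l := m + 1 - level m n (fun j => m + 1 - c j) l.

Definition cell t i := n + n + n + (t + (i + (i + (i + (i + i))))).
Definition flat l k := l * N + k.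

Definition header (f : nat -> nat) := [/\ f R_n = n, f R_m = m, f R_size = N & f R_base = n + n + n].
Definition jobs_in (h : nat -> nat) := forall j, j < n ->
  [/\ h (j + (j + j) + 0) = r j, h (j + (j + j) + 1) = d j & h (j + (j + j) + 2) = p j].
Definition table_in (h : nat -> nat) := forall i, i < N * N -> h (cell T_mult i) = i * N.
Definition latest_in (h : nat -> nat) := forall k, k < N -> h (cell T_latest k) = V k.
Definition ects_in (h : nat -> nat) := forall l, l < N -> h (cell T_ect l) = U l.

Lemma eval_At s t e : header (regs s) -> eval (At t e) s = cell t (eval e s).
Proof. by case=> _ _ _ /= ->. Qed.

Lemma eval_Add s a b : eval (Add a b) s = eval a s + eval b s.
Proof. by []. Qed.

Lemma eval_Get s t e : header (regs s) -> eval (Get t e) s = mem s (cell t (eval e s)).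
Proof. by case=> _ _ _ /= ->. Qed.

Lemma eval_Flat s e f : header (regs s) -> table_in (mem s) -> eval e s < N * N ->
  eval (Flat e f) s = flat (eval e s) (eval f s).
Proof. by move=> hd tb lt; rewrite /Flat eval_Add eval_Get // tb. Qed.

Lemma eval_Datum s j : jobs_in (mem s) -> eval j s < n ->
  [/\ eval (Datum 0 j) s = r (eval j s), eval (Datum 1 j) s = d (eval j s)
    & eval (Datum 2 j) s = p (eval j s)].
Proof. by move=> inp /inp[]. Qed.

Lemma eval_Latest s j : jobs_in (mem s) -> eval j s < n ->
  eval (Latest j) s = q (eval j s).
Proof. by move=> inp jn /=; have [_ -> ->] := inp _ jn. Qed.

Lemma eval_Ect s j : jobs_in (mem s) -> eval j s < n ->
  eval (Ect j) s = c (eval j s).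
Proof. by move=> inp jn /=; have [-> _ ->] := inp _ jn. Qed.

Lemma eval_Max s e f : eval (Max e f) s = maxn (eval e s) (eval f s).
Proof. by rewrite maxnE. Qed.

Lemma den_Lt a b cm s :
  den (Lt a b cm) s = if eval a s < eval b s then den cm s else s.
Proof. by rewrite /= addn1. Qed.

Lemma den_Seq c1 c2 s : den (c1;; c2) s = den c2 (den c1 s).
Proof. by []. Qed.

Lemma den_If a b c1 c2 s :
  den (LIf a b c1 c2) s = if eval a s <= eval b s then den c1 s else den c2 s.
Proof. by []. Qed.

Lemma eval_Read a s : eval (Read a) s = mem s (eval a s).
Proof. by []. Qed.

Lemma den_Store a e s : den (LStore a e) s = setmem (eval a s) (eval e s) s.
Proof. by []. Qed.

Lemma setreg_other x v s y : (y == x) = false -> regs (setreg x v s) y = regs s y.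
Proof. by rewrite regs_setreg => ->. Qed.

Lemma cell_inj t t' i i' : t < 5 -> t' < 5 ->
  (cell t i == cell t' i') = (t == t') && (i == i').
Proof. by rewrite /cell; lia. Qed.

Lemma cell_job t i j b : j < n -> b < 3 -> (j + (j + j) + b == cell t i) = false.
Proof. by rewrite /cell; lia. Qed.

(** Euclidean division by n+1: the second index has to be at most n. *)
Lemma flat_inj l k l' k' : k < N -> k' < N ->
  (flat l k == flat l' k') = (l == l') && (k == k').
Proof.
rewrite /flat => kN k'N; apply/eqP/andP => [e|[/eqP -> /eqP -> //]].
have l_l : l = l' by have := congr1 (divn^~ N) e; rewrite /= !divnMDl // !divn_small // !addn0.
by move: e; rewrite l_l => /addnI ->.
Qed.

Lemma flat_lt l k : l < N -> k < N -> flat l k < N * N.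
Proof. by rewrite /flat; nia. Qed.

Lemma den_header cm s : well_formed cm -> header (regs s) -> header (regs (den cm s)).
Proof. by move=> w [h0 h1 h2 h3]; split; rewrite den_frame // well_formed_writes. Qed.

Lemma header_set x v s : 3 < x -> header (regs s) -> header (regs (setreg x v s)).
Proof. by move=> x3 [h0 h1 h2 h3]; split; rewrite regs_setreg; case: eqP => // e; lia. Qed.

Lemma header_frame (f g : nat -> nat) x cm : R_base < x -> well_formed cm -> header f ->
  (forall y, y \notin x :: writes cm -> g y = f y) -> header g.
Proof.
move=> x3 w [h0 h1 h2 h3] fr.
by split; rewrite fr // inE negb_or well_formed_writes // andbT; lia.
Qed.

Lemma table_spec s : header (regs s) -> jobs_in (mem s) ->
  let s' := den table_prog s in jobs_in (mem s') /\ table_in (mem s').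
Proof.
move=> hd inp; rewrite /table_prog; set body := LFor R_size R_col _.
pose J i s := [/\ regs s R_cur = i, regs s R_acc = i * N, jobs_in (mem s) &
   forall i', i' < i -> mem s (cell T_mult i') = i' * N].
have inner s1 i : header (regs s1) -> J i s1 -> J (i + N) (den body s1).
  move=> hd1 J1; have [_ _ e2 _] := hd1.
  rewrite -{1}e2; apply: (den_for (I := fun k => J (i + k))) => //; first by rewrite addn0.
  move=> k s2 _ _ fr _ [r4 r5 jn tb].
  have hd2 : header (regs s2) by apply: header_frame hd1 fr.
  have [_ _ f2 _] := hd2.
  have -> : den (LStore (At T_mult (Reg R_cur)) (Reg R_acc);; LAssign R_cur (Add (Reg R_cur) (Const 1));;
     LAssign R_acc (Add (Reg R_acc) (Reg R_size))) s2 =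
     setreg R_acc ((i + k) * N + N) (setreg R_cur (i + k + 1) (setmem (cell T_mult (i + k)) ((i + k) * N) s2)).
    by rewrite -r5 -r4 -(eval_At 0 (Reg R_cur) hd2) -f2.
  split=> /=.
  - by rewrite /upd /=; lia.
  - by rewrite /upd /=; lia.
  - by move=> j jn'; have := jn j jn'; rewrite /upd !cell_job.
  - move=> i' lt; rewrite /upd cell_inj //=; case: eqP => [-> //|ne].
    by apply: tb; lia.
have [_ _ e2 _] := hd.
have [_ _ jn tb] : J (N * N) (den (LFor R_size R_row body) (setreg R_acc 0 (setreg R_cur 0 s))).
  have -> : N * N = (regs s R_size) * N by rewrite e2.
  apply: (den_for (I := fun k => J (k * N))) => //.
  move=> k s2 _ _ fr _ Jk; rewrite mulSn addnC.
  have hd2 : header (regs s2).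
    by apply: header_frame fr => //; apply: header_set => //; apply: header_set.
  by have [] := inner s2 _ hd2 Jk.
by split.
Qed.

Lemma next_spec key kf s : header (regs s) -> jobs_in (mem s) ->
    (forall s', header (regs s') -> jobs_in (mem s') -> regs s' R_col < n ->
      eval key s' = kf (regs s' R_col)) ->
  regs (den (next_prog key) s) R_acc = next_key m kf n (regs s R_cur).
Proof.
move=> hd inp ek; rewrite /next_prog; set body := Lt _ _ _; rewrite den_Seq.
have [e0 e1 _ _] := hd; rewrite -[X in next_key _ _ X]e0.
apply: (den_for (I := fun i s' => regs s' R_acc = next_key m kf i (regs s R_cur))) => //.
  by rewrite /= /upd /= e1 addn1.
move=> i s' lt r7 fr st ih; have hd' : header (regs s').
  by apply: header_frame fr => //; apply: header_set.
have {}inp : jobs_in (mem s') by rewrite st.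
have ki : eval key s' = kf i by rewrite ek // r7 // -e0.
have r4 : regs s' R_cur = regs s R_cur by rewrite fr.
rewrite setreg_other // /body den_Lt ki [eval (Reg R_cur) _]/= r4 [next_key _ _ _ _]/= -ih.
case: ltnP => // _; rewrite den_Lt ki [eval (Reg R_acc) _]/= andTb.
by case: ltnP => // _; rewrite /= /upd /= ki.
Qed.

Lemma levels_spec t key out kf g s : t < 5 -> header (regs s) -> jobs_in (mem s) ->
    (forall s', header (regs s') -> jobs_in (mem s') -> regs s' R_col < n ->
      eval key s' = kf (regs s' R_col)) ->
    (forall s', header (regs s') -> eval out s' = g (regs s' R_acc)) ->
  let h := mem (den (levels_prog t key out) s) in
  (forall k, k < N -> h (cell t k) = g (level m n kf k)) /\
  (forall a, (forall k, a != cell t k) -> h a = mem s a).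
Proof.
move=> t5 hd inp ek eo; rewrite /levels_prog; set body := (next_prog _;; _).
rewrite den_Seq; have [_ _ e2 _] := hd.
pose J i s' := [/\ regs s' R_cur = iter i (next_key m kf n) 0,
    forall k, k < i -> mem s' (cell t k) = g (level m n kf k) &
    forall a, (forall k, a != cell t k) -> mem s' a = mem s a].
have [_ fill same] : J (regs s R_size) (den (LFor R_size R_row body) (den (LAssign R_cur (Const 0)) s));
  last by rewrite -e2.
apply: (den_for (I := J)) => // i s' lt r6 fr _ [r4 fill same].
have hd' : header (regs s').
  by apply: header_frame fr => //; apply: header_set.
have inp' : jobs_in (mem s').
  move=> j jn; have := inp j jn; rewrite !same // => k; by rewrite cell_job.
have nx := next_spec hd' inp' ek.
rewrite /body !den_Seq.
set s1 := den (next_prog key) s' in nx *; set s2 := den (LAssign R_cur (Reg R_acc)) s1.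
have hd1 : header (regs s1) by apply: den_header.
have hd2 : header (regs s2) by apply: header_set.
have -> : den (LStore (At t (Reg R_row)) out) s2 = setmem (cell t i) (g (level m n kf i)) s2.
  rewrite den_Store eval_At // eo //.
  have -> : eval (Reg R_row) s2 = i by rewrite -r6 /= /upd /= den_frame.
  have -> : regs s2 R_acc = regs s1 R_acc by [].
  by rewrite nx r4 /level iterS.
have m2 : mem s2 = mem s' by rewrite -[LHS]/(mem s1) den_storeless.
split.
- by rewrite /= /upd /= nx r4.
- move=> k ki; rewrite /= -/(mem s2) m2 /upd cell_inj // eqxx /=.
  by case: eqP => [-> //|ne]; apply: fill; lia.
- by move=> a na; rewrite /= m2 /upd (negPf (na i)) same.
Qed.

Lemma longest_spec s u v : header (regs s) -> jobs_in (mem s) ->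
    regs s R_after = u -> regs s R_before = v ->
  let P := regs (den longest_prog s) R_longest in
  (forall j, j < n -> pending u v j -> p j <= P) /\
  (P = 0 \/ exists j, [/\ j < n, pending u v j & p j = P]).
Proof.
move=> hd inp ru rv; rewrite /longest_prog; set body := Lt _ _ _; rewrite den_Seq.
set s0 := den _ s; have hd0 : header (regs s0) by apply: header_set.
have [e0 _ _ _] := hd0.
pose J i s' := (forall j, j < i -> pending u v j -> p j <= regs s' R_longest) /\
  (regs s' R_longest = 0 \/ exists j, [/\ j < i, pending u v j & p j = regs s' R_longest]).
suff : J (regs s0 R_n) (den (LFor R_n R_job body) s0) by rewrite e0.
apply: (den_for (I := J)) => //; first by split=> //; left.
move=> i s' lt r16 fr st [ub wit]; rewrite e0 in lt.
have hd' : header (regs s') by apply: header_frame fr.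
have {}inp : jobs_in (mem s') by rewrite st.
have i_n : eval (Reg R_job) s' < n by rewrite /= r16.
have r18 : regs s' R_after = u by rewrite fr.
have r19 : regs s' R_before = v by rewrite fr.
have ei : eval (Reg R_job) s' = i by [].
have [_ _ ep] := eval_Datum inp i_n.
rewrite /J setreg_other //.
have -> : regs (den body s') R_longest = if pending u v i then maxn (regs s' R_longest) (p i) else regs s' R_longest.
  rewrite /body den_Lt eval_Ect // ei [eval (Reg R_after) _]/= r18 /pending.
  case: ltnP => // _; rewrite andTb den_Lt eval_Latest // ei [eval (Reg R_before) _]/= r19.
  case: ltnP => // _; rewrite den_Lt ep ei [eval (Reg R_longest) _]/= /maxn.
  case: ltnP => // _.
  by rewrite /upd /= -r16; have [_ _ ->] := inp _ i_n.
split.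
  move=> j; rewrite ltnS leq_eqVlt => /orP[/eqP ->|ji] pj.
    by rewrite pj leq_maxr.
  by have := ub j ji pj; case: ifP => // _ ; lia.
case: ifP => [pi|_]; last first.
  by case: wit => [->|[j [ji pj <-]]]; [left | right; exists j; split=> //; lia].
rewrite /maxn; case: ltnP => _; first by right; exists i.
by case: wit => [->|[j [ji pj <-]]]; [left | right; exists j; split=> //; lia].
Qed.

Definition env (h : nat -> nat) := [/\ jobs_in h, table_in h, latest_in h & ects_in h].

Lemma env_same (h h' : nat -> nat) :
    (forall x, (forall i, x != cell T_cost i) -> (forall i, x != cell T_start i) -> h' x = h x) ->
  env h -> env h'.
Proof.
move=> same [jn tb lat ec]; split.
- by move=> j jlt; rewrite !same; try (by move=> i; rewrite cell_job); apply: jn.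
- by move=> i lt; rewrite same ?tb // => i'; rewrite cell_inj.
- by move=> i lt; rewrite same ?lat // => i'; rewrite cell_inj.
- by move=> i lt; rewrite same ?ec // => i'; rewrite cell_inj.
Qed.

Definition cand (h : nat -> nat) P l k l' k' :=
  h (cell T_cost (flat l k')) + maxn P (U l' + 1 - V k') + h (cell T_cost (flat l' k)).

(** Invariant of the search for the best transition, [seen] being the set of
    transitions tried so far and B0 the initial value of the minimum. *)
Definition scanned (h : nat -> nat) P l k B0 (seen : nat -> nat -> bool) (f : nat -> nat) :=
  [/\ f R_best <= B0,
      forall l' k', l' < l -> k' < k -> seen l' k' -> f R_best <= cand h P l k l' k'
    & [/\ f R_best = B0, f R_bestv = 0 & f R_bestu = 0] \/
      [/\ f R_bestv < k, f R_bestu < l & f R_best = cand h P l k (f R_bestu) (f R_bestv)]].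

Lemma scanned_ext h P l k B0 (seen seen' : nat -> nat -> bool) (f g : nat -> nat) :
    (forall l' k', l' < l -> k' < k -> seen' l' k' -> seen l' k') ->
    g R_best = f R_best -> g R_bestv = f R_bestv -> g R_bestu = f R_bestu ->
  scanned h P l k B0 seen f -> scanned h P l k B0 seen' g.
Proof.
move=> sub e1 e2 e3 [b1 b2 b3]; rewrite /scanned e1 e2 e3; split=> // l' k' ll kk sn.
by apply: b2 => //; apply: sub.
Qed.

Lemma try_spec s P l k l' k' B0 seen :
    header (regs s) -> env (mem s) ->
    regs s R_v = k -> regs s R_u = l -> regs s R_longest = P -> regs s R_tryv = k' -> regs s R_tryu = l' ->
    k < N -> l < N -> k' < k -> l' < l ->
    scanned (mem s) P l k B0 seen (regs s) ->
  scanned (mem s) P l k B0 (fun l2 k2 => seen l2 k2 || ((l2 == l') && (k2 == k')))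
    (regs (den try_prog s)).
Proof.
move=> hd [_ tb lat ec] r8 r9 r10 r14 r15 kN lN kk ll [b1 b2 b3].
have rlt x y : x < N -> regs s y = x -> eval (Reg y) s < N * N by move=> xN /= ->; nia.
rewrite /try_prog; set e := (X in LAssign R_cost X).
have ev : eval e s = cand (mem s) P l k l' k'.
  rewrite /e 2!eval_Add eval_Max !eval_Get // !eval_Flat //; last 2 first.
  - by apply: rlt r15; lia.
  - by apply: rlt r9.
  rewrite /cand -[eval (Defs.Sub _ _) s]/(eval (Add (Get T_ect (Reg R_tryu)) (Const 1)) s - eval (Get T_latest (Reg R_tryv)) s).
  rewrite eval_Add !eval_Get //= r8 r9 r10 r14 r15 lat ?ec //; lia.
rewrite den_Seq den_Lt.
have -> : den (LAssign R_cost e) s = setreg R_cost (cand (mem s) P l k l' k') s by rewrite -ev.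
set x := cand _ _ _ _ _ _ in ev *.
have -> : eval (Reg R_cost) (setreg R_cost x s) < eval (Reg R_best) (setreg R_cost x s) = (x < regs s R_best) by [].
case: ltnP => xb.
  rewrite /scanned !den_Seq /= /upd /= r14 r15; split.
  - by lia.
  - move=> l2 k2 l2l k2k /orP[sn|/andP[/eqP -> /eqP ->]] //.
    by have := b2 l2 k2 l2l k2k sn; lia.
  - by right.
rewrite /scanned /= /upd /=; split=> //.
move=> l2 k2 l2l k2k /orP[sn|/andP[/eqP -> /eqP ->]] //.
by apply: b2.
Qed.

(** The initial value m+1 exceeds the cost of every schedule, so it is always
    replaced if a job is pending. Without pending jobs the initial value 0 stays,
    and the recorded transition (0, 0) is irrelevant. *)
Lemma best_spec s P l k :
    header (regs s) -> env (mem s) ->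
    regs s R_v = k -> regs s R_u = l -> regs s R_longest = P -> k < N -> l < N ->
  scanned (mem s) P l k (if P == 0 then 0 else m.+1) (fun _ _ => true)
    (regs (den best_prog s)).
Proof.
move=> hd en r8 r9 r10 kN lN; set B0 := if _ then _ else _.
rewrite /best_prog; set inner := LFor R_size R_tryu _; rewrite !den_Seq.
set s0 := den (LIf _ _ _ _) s.
have s0E : s0 = setreg R_best B0 s.
  rewrite /s0 /= /B0 -r10 leqn0; case: eqP => // _.
  by have [_ -> _ _] := hd; rewrite addn1.
set s1 := den (LAssign R_bestu _) _.
have s1E : s1 = setreg R_bestu 0 (setreg R_bestv 0 (setreg R_best B0 s)) by rewrite /s1 s0E.
have m1 : mem s1 = mem s by rewrite s1E.
have hd1 : header (regs s1) by rewrite s1E; do 3 apply: header_set => //.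
have [_ _ e2 _] := hd1.
pose J i s' := scanned (mem s) P l k B0 (fun _ k2 => k2 < i) (regs s').
have : J (regs s1 R_size) (den (LFor R_size R_tryv (Lt (Reg R_tryv) (Reg R_v) inner)) s1); last first.
  by apply: scanned_ext => // l' k' ll kk _; rewrite e2; lia.
apply: (den_for (I := J)) => //.
  by rewrite s1E /J /scanned /= /upd /=; split=> //; left.
move=> k' s2 _ r14 fr st Jk; rewrite /J den_Lt.
have r8' : regs s2 R_v = k by rewrite fr // s1E.
have -> : eval (Reg R_tryv) s2 < eval (Reg R_v) s2 = (k' < k) by rewrite /= r14 r8'.
case: ltnP => k'k; last first.
  by apply: scanned_ext Jk => // l2 k2 _ k2k _; lia.
have hd2 : header (regs s2) by apply: header_frame fr.
have m2 : mem s2 = mem s by rewrite st.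
have [_ _ f2 _] := hd2.
pose J2 i s' := scanned (mem s) P l k B0 (fun l2 k2 => (k2 < k') || ((k2 == k') && (l2 < i))) (regs s').
have : J2 (regs s2 R_size) (den inner s2); last first.
  by apply: scanned_ext => // l2 k2 l2l k2k; rewrite f2; lia.
apply: (den_for (I := J2)) => //.
  by apply: scanned_ext Jk => // l2 k2 l2l k2k; lia.
move=> l' s3 _ r15 fr3 st3 Jl; rewrite /J2 den_Lt.
have r9' : regs s3 R_u = l by rewrite fr3 // fr // s1E.
have -> : eval (Reg R_tryu) s3 < eval (Reg R_u) s3 = (l' < l) by rewrite /= r15 r9'.
case: ltnP => l'l; last first.
  by apply: scanned_ext Jl => // l2 k2 l2l k2k; lia.
have hd3 : header (regs s3) by apply: header_frame fr3.
have m3 : mem s3 = mem s by rewrite st3.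
have try : scanned (mem s3) P l k B0 (fun l2 k2 => (k2 < k') || ((k2 == k') && (l2 < l')) || ((l2 == l') && (k2 == k')))
    (regs (den try_prog s3)).
  apply: try_spec => //; rewrite ?m3 //.
  - by rewrite fr3.
  - by rewrite fr3 // fr // s1E.
  - by rewrite fr3.
rewrite m3 in try; apply: scanned_ext try => // l2 k2 _ _; lia.
Qed.

Definition sol (h : nat -> nat) l k j := h (cell T_start (flat (flat l k) j)).

(** When the transition is the dummy (0, 0), a row may be copied onto itself; this
    is harmless because each entry is read before it is written. *)
Lemma copy_spec s l k b a :
    header (regs s) -> env (mem s) ->
    regs s R_v = k -> regs s R_u = l -> regs s R_bestv = b -> regs s R_bestu = a ->
    k < N -> l < N -> b < N -> a < N ->
  let h := mem (den copy_prog s) in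
  (forall j, j < n -> sol h l k j =
     merge r q p (V b) (U a) (sol (mem s) l b) (sol (mem s) a k) j) /\
  (forall x, (forall j, j < n -> x != cell T_start (flat (flat l k) j)) -> h x = mem s x).
Proof.
move=> hd en r8 r9 r12 r13 kN lN bN aN; rewrite /copy_prog.
set body := LIf _ _ _ _.
pose J i s' := [/\ env (mem s'), forall j, j < i -> sol (mem s') l k j =
     merge r q p (V b) (U a) (sol (mem s) l b) (sol (mem s) a k) j &
   forall x, (forall j, j < i -> x != cell T_start (flat (flat l k) j)) -> mem s' x = mem s x].
have [e0 _ _ _] := hd.
have [_ fill same] : J (regs s R_n) (den (LFor R_n R_job body) s); last first.
  by split=> [j jn|x nx]; [apply: fill; rewrite e0 | apply: same => j; rewrite e0; apply: nx].
apply: (den_for (I := J)) => // i s' lt r16 fr _ [en' fill same].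
rewrite e0 in lt.
have hd' : header (regs s') by apply: header_frame fr.
have [jn tb lat ec] := en'.
have r8' : regs s' R_v = k by rewrite fr.
have r9' : regs s' R_u = l by rewrite fr.
have r12' : regs s' R_bestv = b by rewrite fr.
have r13' : regs s' R_bestu = a by rewrite fr.
have i_n : eval (Reg R_job) s' < n by rewrite /= r16.
have addr l2 k2 y z : l2 < N -> k2 < N -> regs s' y = l2 -> regs s' z = k2 ->
    eval (start_at (Reg y) (Reg z)) s' = cell T_start (flat (flat l2 k2) i).
  move=> l2N k2N ry rz; have lt1 : eval (Reg y) s' < N * N by rewrite /= ry; nia.
  rewrite /start_at eval_At // eval_Flat // eval_Flat // /= ?ry ?rz ?r16 //.
  exact: flat_lt.
have old l2 k2 : l2 < N -> k2 < N -> mem s' (cell T_start (flat (flat l2 k2) i)) = sol (mem s) l2 k2 i.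
  move=> l2N k2N; apply: same => j ji; rewrite cell_inj // flat_inj; lia.
pose v := merge r q p (V b) (U a) (sol (mem s) l b) (sol (mem s) a k) i.
have -> : den body s' = setmem (cell T_start (flat (flat l k) i)) v s'.
  have ei : eval (Reg R_job) s' = i by [].
  rewrite /body !den_If !eval_Add !eval_Get // eval_Latest // eval_Ect // ei.
  rewrite !den_Store !(addr l k) // (eval_Read (start_at (Reg R_u) (Reg R_bestv))).
  rewrite (eval_Read (start_at (Reg R_bestu) (Reg R_v))) (addr l b) // (addr a k) // !old // eval_Max.
  have [-> _ _] := eval_Datum jn i_n; rewrite eval_Get // ei /= r12' r13' lat // ec //.
  by rewrite /v /merge !addn1; case: ifP => _ //; case: ifP.
split.
- by apply: env_same en' => x n3 n4; rewrite /= /upd (negPf (n4 _)).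
- move=> j; rewrite ltnS leq_eqVlt /sol /= /upd => /orP[/eqP ->|ji]; first by rewrite eqxx.
  rewrite cell_inj // flat_inj; [|lia..].
  have -> : (j == i) = false by lia.
  by rewrite !andbF; apply: fill.
- move=> x nx; rewrite /= /upd; have := nx i (leqnn _); case: eqP => // _ _.
  by apply: same => j ji; apply: nx; lia.
Qed.

Notation load := (load m n p).
Notation feasible := (feasible n r q).

Definition good (h : nat -> nat) l k :=
  [/\ feasible (pending (U l) (V k)) (sol h l k),
      load (pending (U l) (V k)) (sol h l k) <= h (cell T_cost (flat l k))
    & forall s, feasible (pending (U l) (V k)) s ->
        h (cell T_cost (flat l k)) <= load (pending (U l) (V k)) s].

Lemma q_range j : j < n -> 0 < q j <= m.
Proof. by move/window => [r0 rq p0 qm]; lia. Qed.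

Lemma c_range j : j < n -> 0 < m + 1 - c j <= m.
Proof. by move/window => [r0 rq p0 qm]; rewrite /ect; lia. Qed.

Lemma V_index i k : i < n -> q i < V k -> exists2 k', k' < k & V k' = q i.
Proof.
move=> i_n qV; have [k' _ e] := level_surj q_range i_n.
by exists k' => //; apply: (level_lt_index q_range); rewrite e.
Qed.

Lemma U_index j l : j < n -> U l < c j -> exists2 l', l' < l & U l' = c j.
Proof.
move=> jn Uc; have [l' _ e] := level_surj c_range jn.
have [r0 rq p0 qm] := window jn.
exists l'; last by rewrite /U e /ect; lia.
by apply: (level_lt_index c_range); move: Uc (c_range jn); rewrite e /U; lia.
Qed.

(** The recurrence is exact. By [split_exists] some transition costs at most as
    much as any given schedule, so the recorded minimum is a lower bound; it is
    at most m, hence differs from its initial value and is attained by a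
    transition, whose merged schedule costs no more by [load_merge]. *)
Lemma cell_optimal h P l k f :
    (forall j, j < n -> pending (U l) (V k) j -> p j <= P) ->
    P = 0 \/ (exists j, [/\ j < n, pending (U l) (V k) j & p j = P]) ->
    (forall k', k' < k -> good h l k') -> (forall l', l' < l -> good h l' k) ->
    scanned h P l k (if P == 0 then 0 else m.+1) (fun _ _ => true) f ->
  let s := merge r q p (V (f R_bestv)) (U (f R_bestu)) (sol h l (f R_bestv)) (sol h (f R_bestu) k) in
  [/\ feasible (pending (U l) (V k)) s,
      load (pending (U l) (V k)) s <= f R_best
    & forall s', feasible (pending (U l) (V k)) s' ->
        f R_best <= load (pending (U l) (V k)) s'].
Proof.
move=> ub wit gk gl [le0 minimal witness].
have [P0|P0] := eqVneq P 0.
  have none j : j < n -> ~~ pending (U l) (V k) j.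
    by move=> jn; apply/negP => /(ub j jn); have [_ _ p0 _] := window jn; lia.
  rewrite P0 eqxx in le0; split.
  - by move=> j jn pj; case/negP: (none j jn).
  - by rewrite load_pending0.
  - by lia.
have [i0 [i0n Ji0 pi0]] : exists j, [/\ j < n, pending (U l) (V k) j & p j = P].
  by case: wit => // e; rewrite e in P0.
have lower s' : feasible (pending (U l) (V k)) s' -> f R_best <= load (pending (U l) (V k)) s'.
  move=> fs; rewrite -pi0 in ub.
  have [s1 [i [j [[i_n /andP[Ui qV]] [jn /andP[Uj cV]] fs1 sp]]]] := split_exists window fs i0n Ji0 ub.
  have [k' kk eV] := V_index i_n qV; have [l' ll eU] := U_index jn Uj.
  have := minimal l' k' ll kk isT; rewrite /cand eV eU addn1 -pi0.
  have [_ _ mink] := gk k' kk; have [_ _ minl] := gl l' ll.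
  have fk : feasible (pending (U l) (V k')) s1.
    apply: feasible_sub fs1 => j' _ /andP[U' V']; rewrite pendingE U' /=.
    by move: V'; rewrite eV; lia.
  have fl : feasible (pending (U l') (V k)) s1.
    apply: feasible_sub fs1 => j' _ /andP[U' V']; rewrite pendingE V' andbT.
    by move: U'; rewrite eU; lia.
  by have := mink _ fk; have := minl _ fl; rewrite eV eU; lia.
have le : f R_best <= m.
  apply: leq_trans (lower r _) (load_le _ _ _ _ _) => j jn _.
  by have [r0 -> _ _] := window jn; rewrite leqnn.
case: witness => [[e _ _]|[bk bl e]].
  by move: le; rewrite e (negPf P0) ltnn.
have [fk lk _] := gk _ bk; have [fl ll _] := gl _ bl.
move=> s; split=> //; first exact: (feasible_merge window fk fl).
apply: leq_trans (load_merge window _ _ _ _ ub) _.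
by rewrite e /cand addn1; lia.
Qed.

Lemma good_same (h h' : nat -> nat) l k :
    h' (cell T_cost (flat l k)) = h (cell T_cost (flat l k)) ->
    (forall j, j < n -> sol h' l k j = sol h l k j) ->
  good h l k -> good h' l k.
Proof.
move=> ev es [fh lh mh]; rewrite /good ev; split=> //.
  by move=> j jn pj; rewrite es //; apply: fh.
by rewrite (@load_eq m n p _ (pending (U l) (V k)) _ (sol h l k)) // => j jn _; apply: es.
Qed.

Lemma cell_spec s l k : header (regs s) -> env (mem s) ->
    regs s R_v = k -> regs s R_u = l -> k < N -> l < N ->
    (forall k', k' < k -> good (mem s) l k') -> (forall l', l' < l -> good (mem s) l' k) ->
  let h := mem (den cell_prog s) in
  [/\ env h, good h l k & forall l' k', l' < N -> k' < N -> (l', k') != (l, k) ->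
    good (mem s) l' k' -> good h l' k'].
Proof.
move=> hd en r8 r9 kN lN gk gl.
have [jn tb lat ec] := en.
rewrite /cell_prog !den_Seq.
set s1 := den (LAssign R_before _) _.
have s1E : s1 = setreg R_before (V k) (setreg R_after (U l) s).
  have hd' : header (regs (setreg R_after (U l) s)) by apply: header_set.
  have e18 : eval (Get T_ect (Reg R_u)) s = U l by rewrite eval_Get //= r9 ec.
  have e19 : eval (Get T_latest (Reg R_v)) (setreg R_after (U l) s) = V k.
    by rewrite eval_Get //= /upd /= r8 lat.
  by rewrite -e19 -e18.
have m1 : mem s1 = mem s by rewrite s1E.
have hd1 : header (regs s1) by rewrite s1E; do 2 apply: header_set => //.
have jn1 : jobs_in (mem s1) by rewrite m1.
have r18 : regs s1 R_after = U l by rewrite s1E.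
have r19 : regs s1 R_before = V k by rewrite s1E.
have [ub wit] := longest_spec hd1 jn1 r18 r19.
set s2 := den longest_prog s1 in ub wit *.
have m2 : mem s2 = mem s by rewrite den_storeless.
have hd2 : header (regs s2) by apply: den_header.
have r8' : regs s2 R_v = k by rewrite den_frame // s1E.
have r9' : regs s2 R_u = l by rewrite den_frame // s1E.
have en2 : env (mem s2) by rewrite m2.
have sc := best_spec hd2 en2 r8' r9' erefl kN lN.
set s3 := den best_prog s2 in sc *; rewrite m2 in sc.
have [fe lo hi] := cell_optimal ub wit gk gl sc.
have [bN aN] : regs s3 R_bestv < N /\ regs s3 R_bestu < N.
  by case: sc => _ _ [[_ -> ->]|[b a _]] //; split; lia.
have m3 : mem s3 = mem s by rewrite den_storeless.
have hd3 : header (regs s3) by apply: den_header.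
have r8'' : regs s3 R_v = k by rewrite den_frame.
have r9'' : regs s3 R_u = l by rewrite den_frame.
set v := regs s3 R_best in lo hi.
have s4E : den (LStore (At T_cost (Flat (Reg R_u) (Reg R_v))) (Reg R_best)) s3 =
    setmem (cell T_cost (flat l k)) v s3.
  rewrite den_Store eval_At // eval_Flat ?m3 //= ?r8'' ?r9'' //; nia.
rewrite s4E; set s4 := setmem _ _ _.
have m4 x : mem s4 x = if x == cell T_cost (flat l k) then v else mem s x.
  by rewrite /s4 /= /upd m3.
have en4 : env (mem s4).
  by apply: env_same en => x n3 _; rewrite m4 (negPf (n3 _)).
have hd4 : header (regs s4) by [].
have [fill same] := copy_spec hd4 en4 (r8'' : regs s4 R_v = k) (r9'' : regs s4 R_u = l) erefl erefl kN lN bN aN.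
set h := mem (den copy_prog s4) in fill same *.
have sol4 l' k' : sol (mem s4) l' k' =1 sol (mem s) l' k'.
  by move=> j; rewrite /sol m4 cell_inj.
have val : h (cell T_cost (flat l k)) = v.
  by rewrite same ?m4 ?eqxx // => j; rewrite cell_inj.
have sc' j : j < n -> sol h l k j = merge r q p (V (regs s3 R_bestv)) (U (regs s3 R_bestu))
   (sol (mem s) l (regs s3 R_bestv)) (sol (mem s) (regs s3 R_bestu) k) j.
  by move=> jlt; rewrite fill // /merge !sol4.
split.
- by apply: env_same en4 => x n3 n4; apply: same => j _.
- rewrite /good val; split=> //.
    by move=> j jlt pj; rewrite sc' //; apply: fe.
  apply: leq_trans lo; rewrite leq_eqVlt; apply/orP; left; apply/eqP.
  by apply: load_eq => // j jlt _; apply: sc'.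
move=> l' k' l'N k'N ne; apply: good_same.
  rewrite same; last by move=> j; rewrite cell_inj.
  rewrite m4 cell_inj // flat_inj //.
  by move: ne; rewrite xpair_eqE => /negPf ->.
move=> j jlt; rewrite /sol same -/(sol (mem s4) l' k' j) ?sol4 // => j' j'lt.
rewrite cell_inj // flat_inj ?flat_inj //; try lia.
by move: ne; rewrite xpair_eqE => /negPf ->.
Qed.

(** The result overwrites input cells only; the schedules lie above the input and
    remain readable. *)
Lemma output_spec s : header (regs s) -> table_in (mem s) ->
  forall j, j < n -> mem (den output_prog s) j = sol (mem s) n n j.
Proof.
move=> hd tb; rewrite /output_prog; set body := LStore _ _.
have [e0 _ _ _] := hd.
pose J i s' := (forall j, j < i -> mem s' j = sol (mem s) n n j) /\
  (forall x, n <= x -> mem s' x = mem s x).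
suff [] : J (regs s R_n) (den (LFor R_n R_job body) s) by rewrite e0.
apply: (den_for (I := J)) => // i s' lt r16 fr _ [fill same].
rewrite e0 in lt.
have hd' : header (regs s') by apply: header_frame fr.
have big t x : n <= cell t x by rewrite /cell; lia.
have tb' : table_in (mem s') by move=> x xlt; rewrite same // tb.
have [f0 _ _ _] := hd'.
have -> : den body s' = setmem i (sol (mem s) n n i) s'.
  rewrite /body den_Store eval_Read /start_at eval_At // eval_Flat // eval_Flat //= ?f0 ?r16.
  - by rewrite same.
  - by nia.
  - by rewrite -/(flat n n) flat_lt.
  - by nia.
split.
  move=> j; rewrite ltnS leq_eqVlt /= /upd => /orP[/eqP ->|ji]; first by rewrite eqxx.
  by case: eqP => [|_]; [lia | apply: fill].
by move=> x nx; rewrite /= /upd; case: eqP => [|_]; [lia | apply: same].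
Qed.

Lemma main_spec s : header (regs s) -> jobs_in (mem s) ->
  let h := mem (den main_prog s) in
  feasible xpredT h /\
  forall s', feasible xpredT s' -> load xpredT h <= load xpredT s'.
Proof.
move=> hd jn; rewrite /main_prog !den_Seq.
set s1 := den table_prog s.
have [jn1 tb1] : jobs_in (mem s1) /\ table_in (mem s1) by apply: table_spec.
have hd1 : header (regs s1) by apply: den_header.
have keyV s' : header (regs s') -> jobs_in (mem s') -> regs s' R_col < n ->
  eval (Latest (Reg R_col)) s' = q (regs s' R_col) by move=> _ inp lt; rewrite eval_Latest.
have keyU s' : header (regs s') -> jobs_in (mem s') -> regs s' R_col < n ->
    eval (Defs.Sub (Add (Reg R_m) (Const 1)) (Ect (Reg R_col))) s' = m + 1 - c (regs s' R_col).
  move=> [_ e1 _ _] inp lt.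
  rewrite -[LHS]/(regs s' R_m + 1 - eval (Ect (Reg R_col)) s') e1.
  by rewrite eval_Ect.
have [lat same2] := @levels_spec 1 (Latest (Reg R_col)) (Reg R_acc) q id s1 isT hd1 jn1 keyV (fun _ _ => erefl).
set s2 := den _ s1 in lat same2 *.
have hd2 : header (regs s2) by apply: den_header.
have jn2 : jobs_in (mem s2).
  by move=> j jlt; rewrite !same2; try (by move=> i; rewrite cell_job); apply: jn1.
have tb2 : table_in (mem s2) by move=> i ilt; rewrite same2 ?tb1 // => k; rewrite cell_inj.
have [ec same3] := @levels_spec 2 _ (Defs.Sub (Add (Reg R_m) (Const 1)) (Reg R_acc)) (fun j => m + 1 - c j) (fun b => m + 1 - b)
  s2 isT hd2 jn2 keyU (fun s' hd' => let: And4 _ e _ _ := hd' in congr1 (fun x => x + 1 - regs s' R_acc) e).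
set s3 := den _ s2 in ec same3 *.
have hd3 : header (regs s3) by apply: den_header.
have en3 : env (mem s3).
  split=> //.
  - by move=> j jlt; rewrite !same3; try (by move=> i; rewrite cell_job); apply: jn2.
  - by move=> i ilt; rewrite same3 ?tb2 // => k; rewrite cell_inj.
  - by move=> i ilt; rewrite same3 ?lat // => k; rewrite cell_inj.
set s4 := den (LFor R_size R_v _) s3.
have hd4 : header (regs s4) by apply: den_header.
have [en4 good4] : env (mem s4) /\ forall l k, l < N -> k < N -> good (mem s4) l k.
  pose J k s' := env (mem s') /\ forall l k', l < N -> k' < k -> good (mem s') l k'.
  have [_ _ e2 _] := hd3; suff : J (regs s3 R_size) s4 by rewrite e2.
  apply: (den_for (I := J)) => // k s5 klt r8 fr _ [en5 g5].
  rewrite e2 in klt.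
  have hd5 : header (regs s5) by apply: header_frame fr.
  pose J2 i s' := env (mem s') /\ forall l k', l < N ->
    (k' < k) || ((k' == k) && (l < i)) -> good (mem s') l k'.
  have [_ _ f2 _] := hd5.
  have [en6 g6] : J2 (regs s5 R_size) (den (LFor R_size R_u cell_prog) s5); last first.
    split=> // l k' lN kk; apply: g6 => //; rewrite f2; lia.
  apply: (den_for (I := J2)) => //.
    by split=> // l k' lN kk; apply: g5 => //; lia.
  move=> l s6 llt r9 fr6 _ [en6 g6]; rewrite f2 in llt.
  have hd6 : header (regs s6) by apply: header_frame fr6.
  have r8' : regs s6 R_v = k by rewrite fr6.
  have [||en7 g7 keep] := cell_spec hd6 en6 r8' r9 klt llt.
  - by move=> k' kk; apply: g6 => //; rewrite kk.
  - by move=> l' ll; apply: g6; [lia | rewrite eqxx ll orbT].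
  split=> // l' k' l'N kk.
  have [[-> ->] //|ne] := eqVneq (l', k') (l, k).
  apply: keep => //; first by lia.
  by apply: g6 => //; move: ne; rewrite xpair_eqE; lia.
have [_ tb4 _ _] := en4.
have out := output_spec hd4 tb4.
set h := mem (den output_prog s4) in out *.
have [fe lo hi] := good4 n n (ltnSn n) (ltnSn n).
have all j : j < n -> pending (U n) (V n) j.
  move=> jlt; rewrite pendingE (level_last q_range) /U (level_last c_range).
  by have [r0 rq p0 qm] := window jlt; rewrite /ect; lia.
split.
  by move=> j jlt _; rewrite out //; apply: fe => //; apply: all.
move=> s' fs'.
have fs : feasible (pending (U n) (V n)) s' by move=> j jlt _; apply: fs'.
have := leq_trans lo (hi _ fs).
rewrite (@load_eq m n p _ xpredT _ h); last 2 first.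
- by move=> j jlt; rewrite all.
- by move=> j jlt _; rewrite out.
by rewrite (@load_eq m n p _ xpredT s' s') // => j jlt; rewrite all.
Qed.

End Correctness.

(** * From numbers back to instances *)

Definition program : cmd :=
  Seq (Assign R_size (Add (Reg R_n) (Const 1)))
    (Seq (Assign R_base (Add (Add (Reg R_n) (Reg R_n)) (Reg R_n))) (compile main_prog)).

Section Instance.

Variable I : instance.
Notation n := (njobs I).
Notation m := (npaths I).

Definition datum b j := mem (input I) (j + (j + j) + b).

Lemma datumE (j : 'I_n) b : b < 3 ->
  datum b j = nth 0 [:: release j; deadline j; duration j] b.
Proof.
move=> b3; rewrite /datum /=.
have -> : j + (j + j) + b = j * 3 + b by lia.
rewrite divnMDl // divn_small // addn0 modnMDl modn_small //.
by rewrite valK.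
Qed.

Lemma instance_window j : j < n ->
  [/\ 0 < datum 0 j, datum 0 j <= datum 1 j + 1 - datum 2 j, 0 < datum 2 j
    & datum 1 j + 1 - datum 2 j + datum 2 j <= m.+1].
Proof.
move=> jn; rewrite -[j]/(val (Ordinal jn)) !datumE //=.
set i := Ordinal jn; have : [/\ 1 <= release i <= deadline i, deadline i <= m
  & 1 <= duration i <= deadline i - release i + 1] by case: (I) i.
by case; split; lia.
Qed.

(** Indices of paths start at 1 while ordinals start at 0, hence the shift. *)
Lemma cost_load (R : selection I) s : (forall j, R j = block_at j (s (val j))) ->
  cost R = load m n (datum 2) xpredT s.
Proof.
move=> RE; rewrite /cost /load big_add1 big_mkord /= -sum1_card big_mkcond /=.
apply: eq_bigr => i _.
suff -> : (i \in \bigcup_j R j) = busy n (datum 2) xpredT s i.+1 by case: busy.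
apply/idP/idP => [/bigcupP[j _]|/busyP[j [jn _ ij]]].
  rewrite RE inE => ij; apply/busyP; exists (val j); split=> //; first exact: ltn_ord.
  by have [_ _] := instance_window (ltn_ord j); move: ij; rewrite datumE //=; lia.
apply/bigcupP; exists (Ordinal jn) => //; rewrite RE inE /=.
by move: ij; rewrite -[j]/(val (Ordinal jn)) datumE //=; lia.
Qed.

Notation feasible := (feasible n (datum 0) (fun j => datum 1 j + 1 - datum 2 j)).

Lemma possessionP (j : 'I_n) (B : {set 'I_m}) :
  reflect (exists2 s, datum 0 j <= s <= datum 1 j + 1 - datum 2 j & B = block_at j s)
    (B \in possessions j).
Proof.
have := instance_window (ltn_ord j); rewrite !datumE //= => -[r0 rq p0 qm].
apply: (iffP imsetP) => [[s]|[s sr ->]].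
  by rewrite inE => sr ->; exists s => //; lia.
have sm : s < m.+1 by lia.
by exists (Ordinal sm) => //; rewrite inE /=; lia.
Qed.

Lemma optimal_output s : feasible xpredT (mem s) ->
    (forall f, feasible xpredT f ->
      load m n (datum 2) xpredT (mem s) <= load m n (datum 2) xpredT f) ->
  is_optimal (output I s).
Proof.
move=> fe opt; split=> [j|R' sol].
  by apply/possessionP; exists (mem s j) => //; apply: fe.
have /fin_all_exists[f fP] (j : 'I_n) : exists x,
    datum 0 j <= x <= datum 1 j + 1 - datum 2 j /\ R' j = block_at j x.
  by have /possessionP[x xr e] := sol j; exists x.
pose g j := if insub j is Some i then f i else 0.
have gE (j : 'I_n) : g j = f j by rewrite /g valK.
rewrite (@cost_load _ (mem s)) // (@cost_load R' g); last first.
  by move=> j; rewrite gE; have [] := fP j.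
apply: opt => j jn _; rewrite -[j]/(val (Ordinal jn)) gE.
by have [] := fP (Ordinal jn).
Qed.

End Instance.

Theorem theorem3 :
  exists (prog : cmd) (C : nat), forall I : instance,
    exists (s : state) (t : nat),
      [/\ exec prog (input I) s t,
          is_optimal (output I s)
        & 0 < njobs I -> t <= C * njobs I ^ 4].
Proof.
(* The constant is huge in unary notation and must never be evaluated. *)
have [K KE] : exists K, K = factor main_prog by exists (factor main_prog).
exists program, ((10 + K) * 16) => I.
set n := njobs I.
pose s1 := setreg R_size n.+1 (input I).
pose s0 := setreg R_base (n + n + n) s1.
have run1 : exec (Assign R_size (Add (Reg R_n) (Const 1))) (input I) s1 4.
  by rewrite /s1 -(addn1 n); apply: ExecAssign.
have run2 : exec (Assign R_base (Add (Add (Reg R_n) (Reg R_n)) (Reg R_n))) s1 s0 6.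
  exact: ExecAssign.
have hd : header (npaths I) n (regs s0) by [].
have [t ex le] := @compile_correct main_prog s0 n.+1 main_well_formed (ltn0Sn n)
  (leqnSn n) (leqnn _).
rewrite -KE main_depth in le.
exists (den main_prog s0), (4 + (6 + t)); split.
- exact: ExecSeq run1 (ExecSeq run2 ex).
- have [fe opt] := main_spec (@instance_window I) hd (fun j jn => And3 erefl erefl erefl).
  exact: optimal_output fe opt.
- move=> n0; have p0 : 0 < n ^ 4 by rewrite expn_gt0 n0.
  have : n.+1 ^ 4 <= (n * 2) ^ 4 by rewrite leq_exp2r //; lia.
  by rewrite expnMn (_ : 2 ^ 4 = 16) //; nia.
Qed.
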